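(* Let $(Y,\rho)$ be a metric space and let $U\subset Y$ be a non-empty open set. Then there exists an open set $V\subset U$ such that $\dim_L V\ge \dim_L Y$. In particular, $\dim_{ML}U\ge\dim_L Y$.
   Context: Subsets of a metric space are regarded as metric spaces with the inherited metric. For a metric space $(X,\rho)$, $B(x,r)=\{y\in X:\rho(x,y)\le r\}$ denotes the closed ball in $X$, and $N_r(A)\in\{0,1,2,\dots\}\cup\{\infty\}$ denotes the minimal number of sets of diameter at most $r$ required to cover $A\subset X$. The lower dimension of a metric space $X$ with at least two points is $$\dim_L X=\sup\Big\{\alpha\in\mathbb{R}:\ \exists\, C>0 \text{ such that for all real } 0<r<R\le\operatorname{diam}X \text{ and all } x\in X,\ N_r(B(x,R))\ge C\left(\tfrac{R}{r}\right)^{\alpha}\Big\}\in[0,\infty],$$ where $\operatorname{diam}X$ may be $\infty$. Conventions: $\dim_L\emptyset=0$, and $\dim_L X=0$ if $X$ is a one-point space. The modified lower dimension of a metric space $X$ is $\dim_{ML}X=\sup\{\dim_L E: E\subset X\}$. *)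

(* Defs.v *)
From HB Require Import structures.
From mathcomp Require Import all_boot all_order all_algebra.
From mathcomp Require Import all_classical all_reals all_analysis.

Set Implicit Arguments.
Unset Strict Implicit.
Unset Printing Implicit Defensive.

Import Order.TTheory GRing.Theory Num.Theory.

Local Open Scope classical_set_scope.
Local Open Scope ring_scope.

(* The library already gives [set_type A] the pseudometric structure induced by
   the inclusion; here it becomes a metric space with the inherited distance. *)
Section inherited_metric.
Context {R : realType} {X : metricType R} (A : set X).

Definition sub_mdist (x y : A) : R := mdist (set_val x) (set_val y).

Lemma sub_mdist_ge0 (x y : A) : 0 <= sub_mdist x y.
Proof. exact: mdist_ge0. Qed.

Lemma sub_mdist_positivity (x y : A) : sub_mdist x y = 0 -> x = y.
Proof. by move/mdist_positivity/val_inj. Qed.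

Lemma sub_ballEmdist (x : A) (d : R) : ball x d = [set y | sub_mdist x y < d].
Proof. by rewrite -initial_ballE ballEmdist. Qed.

HB.instance Definition _ := @PseudoMetric_isMetric.Build R (set_type A)
  sub_mdist sub_mdist_ge0 sub_mdist_positivity sub_ballEmdist.

End inherited_metric.

Section lower_dimension.
Context {R : realType}.
Implicit Type X : metricType R.

(* [diam set0 = -oo], so the empty set has diameter at most [r] for every [r]. *)
Definition diam X (A : set X) : \bar R :=
  ereal_sup [set (mdist p.1 p.2)%:E | p in A `*` A].

(* The library's [closed_ball] is the closure of the open ball, which may be
   strictly smaller. *)
Definition cball X (x : X) (r : R) : set X := [set y | mdist x y <= r].

Definition covers_with X (r : R) (A : set X) (n : nat) : Prop :=
  exists F : 'I_n -> set X,
    (forall i, (diam (F i) <= r%:E)%E) /\ A `<=` \bigcup_i F i.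

(* [ereal_inf set0 = +oo] is the value when no finite cover exists. *)
Definition cover_number X (r : R) (A : set X) : \bar R :=
  ereal_inf [set n%:R%:E | n in covers_with r A].

Definition lower_exponent X (alpha : R) : Prop :=
  exists2 C : R, 0 < C &
    forall (r s : R), 0 < r -> r < s -> (s%:E <= diam [set: X])%E ->
    forall x : X,
      ((C * (s / r) `^ alpha)%:E <= cover_number r (cball x s))%E.

Definition dim_L X : \bar R :=
  if `[< exists x y : X, x <> y >]
  then ereal_sup [set alpha%:E | alpha in lower_exponent X]
  else 0%E.

Definition dim_ML X : \bar R := ereal_sup [set dim_L E | E in [set: set X]].

End lower_dimension.

(* Main.v *)
Require Import Defs.
From mathcomp Require Import all_boot all_order all_algebra.
From mathcomp Require Import all_classical all_reals all_analysis.
From mathcomp Require Import ring lra.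

(** A small ball [B(x0, e)] does not work as [V], because near its boundary the
    balls of [V] may be much thinner than those of [Y].  Instead start from
    [{x0}] and repeatedly take open neighbourhoods of radii [d], [d/2], [d/4],
    ...; let [V] be the union of all stages.  A point [y] of [V] is within
    [2 d / 2^m] of some [z] in stage [m], and the ball of radius [d / 2^m]
    about [z] lies in [V].  Choosing [m] with [d / 2^m] comparable to [s], every
    ball of [V] of radius [s <= diam V] contains a ball of [Y] of radius [s/16],
    so every positive exponent admissible for [Y] is admissible for [V], with a
    smaller constant. *)

Import Order.TTheory GRing.Theory Num.Theory.

Local Open Scope classical_set_scope.
Local Open Scope ring_scope.

(** * Lower dimension under isometric embeddings *)

Section lower_dimension_lemmas.
Context {R : realType}.
Implicit Types X Y : metricType R.

Lemma cover_number_ge1 X (r : R) (A : set X) :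
  A !=set0 -> (1 <= cover_number r A)%E.
Proof.
move=> [a Aa]; apply: le_ereal_inf_tmp => _ [n [F [_ AF]] <-].
have [i _ _] := AF _ Aa.
by rewrite lee_fin ler1n (leq_ltn_trans _ (ltn_ord i)).
Qed.

Lemma cover_number_set1 X (r : R) (x : X) (A : set X) :
  0 <= r -> A `<=` [set x] -> (cover_number r A <= 1)%E.
Proof.
move=> r0 Ax; apply: ereal_inf_lbound; exists 1%N => //.
exists (fun=> [set x]); split => [_|a /Ax ax]; last by exists ord0.
by apply: ge_ereal_sup => _ [[p q] [/= -> ->] <-]; rewrite mdistxx lee_fin.
Qed.

Section isometry.
Context {X Y : metricType R} (f : X -> Y).
Hypothesis isof : forall x y, mdist (f x) (f y) = mdist x y.

Lemma diam_isometry (A : set X) : diam (f @` A) = diam A.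
Proof.
congr ereal_sup; apply/seteqP; split.
  move=> _ [[_ _] [/= [a Aa <-] [b Ab <-]] <-].
  by exists (a, b) => //=; rewrite isof.
move=> _ [[a b] [/= Aa Ab] <-]; exists (f a, f b) => /=; last by rewrite isof.
by split; [exists a|exists b].
Qed.

Lemma cover_number_isometry (r : R) (A : set X) (B : set Y) :
  B `<=` f @` A -> (cover_number r B <= cover_number r A)%E.
Proof.
move=> BA; apply: ereal_inf_le_tmp => _ [n [F [Fr AF]] <-]; exists n => //.
exists (fun i => f @` F i); split => [i|_ /BA[a /AF[i _ Fia] <-]].
  by rewrite diam_isometry.
by exists i => //; exists a.
Qed.

End isometry.

Lemma mdist_le_diam X (x y : X) : ((mdist x y)%:E <= diam [set: X])%E.
Proof. by apply: ereal_sup_ubound; exists (x, y). Qed.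

Lemma cball_self X (x : X) (s : R) : 0 <= s -> cball x s x.
Proof. by rewrite /cball /= mdistxx. Qed.

Lemma dim_L_ge0 X : (0 <= dim_L X)%E.
Proof.
rewrite /dim_L; case: ifP => // _; apply: ereal_sup_ubound; exists 0 => //.
exists 1 => // r s r0 rs _ x; rewrite powRr0 mul1r; apply: cover_number_ge1.
by exists x; apply: cball_self; apply: ltW; apply: lt_trans rs.
Qed.

Lemma lower_exponent_isolated X (x y : X) (alpha : R) :
  x <> y -> open [set x] -> lower_exponent X alpha -> alpha <= 0.
Proof.
move=> xy ox [C C0 HC]; rewrite leNgt; apply/negP => a0.
have /nbhs_ballP[e /= e0 ex] : nbhs x [set x] by apply: open_nbhs_nbhs.
have dxy : 0 < mdist x y by rewrite mdist_gt0; apply/eqP.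
(* [s < e] reduces the ball to [x]; [s <= mdist x y] keeps [s] within the diameter. *)
pose s := Num.min (e / 2) (mdist x y).
have s0 : 0 < s by rewrite lt_min divr_gt0.
have se : s < e by rewrite (@le_lt_trans _ _ (e / 2)) ?ge_min ?lexx//; lra.
have sd : (s%:E <= diam [set: X])%E.
  apply: le_trans (mdist_le_diam X x y).
  by rewrite lee_fin ge_min lexx orbT.
have C1 : 1 < C^-1 + 1 by rewrite ltrDr invr_gt0.
pose u := (C^-1 + 1) `^ alpha^-1.
have u1 : 1 < u.
  rewrite (_ : 1 = 1 `^ alpha^-1); last by rewrite powR1.
  by rewrite gt0_ltr_powR ?invr_gt0// nnegrE; lra.
have us : s / u < s by rewrite ltr_pdivrMr ?ltr_pMr//; lra.
have u0 : 0 < u by lra.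
have := HC (s / u) s (divr_gt0 s0 u0) us sd x.
have -> : s / (s / u) = u by field; rewrite !gt_eqF.
rewrite -powRrM mulVf ?gt_eqF// powRr1; last by lra.
rewrite mulrDr mulfV ?gt_eqF// mulr1 => HC1.
suff : ((1 + C)%:E <= 1%:E :> \bar R)%E by rewrite lee_fin; lra.
apply: le_trans HC1 _; apply: (cover_number_set1 _ _ x).
  exact/ltW/divr_gt0.
by move=> z zs; apply: ex; rewrite ballEmdist /=; apply: le_lt_trans se.
Qed.

(* Scales above [c * s] contribute only the bounded factor [c `^ alpha], so
   there the trivial bound [1 <= cover_number] suffices. *)
Lemma dim_L_isometry X Y (f : X -> Y) (c : R) (x0 : X) :
  (forall x y, mdist (f x) (f y) = mdist x y) -> open (range f) ->
  0 < c <= 1 ->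
  (forall x (s : R), 0 < s -> (s%:E <= diam [set: X])%E ->
    exists z, cball z (c * s) `<=` f @` cball x s) ->
  (dim_L Y <= dim_L X)%E.
Proof.
move=> isof openf /andP[c0 c1] fat; rewrite {1}/dim_L.
case: ifP => [/asboolP[p [q pq]]|_]; last exact: dim_L_ge0.
apply: ge_ereal_sup => _ [alpha aY <-].
have [a0|a0] := leP alpha 0; first by rewrite (le_trans _ (dim_L_ge0 X)).
(* If [X] is a single point, [dim_L X] is 0 by convention. The open range then makes [f x0] isolated
   in [Y], which forces [alpha <= 0]. *)
rewrite /dim_L; case: ifPn => [_|/asboolPn X1]; last first.
  have allx0 x : x = x0 by apply: contrapT => ?; apply: X1; exists x, x0.
  have rf : range f = [set f x0].
    apply/seteqP; split=> [_ [x _ <-]|_ ->]; first by rewrite (allx0 x).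
    by exists x0.
  have [z fz] : exists z, f x0 <> z.
    have [/esym fq|] := eqVneq (f x0) p; last by move/eqP; exists p.
    by exists q; rewrite -fq.
  by rewrite lee_fin (lower_exponent_isolated _ _ _ _ fz _ aY)// -rf.
apply: ereal_sup_ubound; exists alpha => //.
have [C C0 HC] := aY.
exists (Num.min C 1 * c `^ alpha).
  by rewrite mulr_gt0 ?powR_gt0// lt_min C0 ltr01.
move=> r s r0 rs sX x; have s0 : 0 < s by apply: lt_trans rs.
have cs0 : 0 < c * s by apply: mulr_gt0.
have [z zs] := fat x s s0 sX.
rewrite -mulrA -powRM ?divr_ge0 ?(ltW c0) ?(ltW r0) ?(ltW s0)// mulrA.
have [rc|rc] := ltP r (c * s).
  apply: (le_trans _ (cover_number_isometry _ isof r _ _ zs)).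
  apply: (le_trans _ (HC r (c * s) r0 rc _ z)).
    by rewrite lee_fin ler_wpM2r ?powR_ge0// ge_min lexx.
  (* The scale [c * s] is admissible in [Y]: it is at most [s], hence at most the diameter of the
     range of [f]. *)
  apply: (@le_trans _ _ s%:E).
    by rewrite lee_fin ler_piMl// ltW.
  apply: le_trans sX _; rewrite -(diam_isometry _ isof).
  by apply: ereal_sup_le => _ [pq' _ <-]; exists pq'.
apply: (@le_trans _ _ 1%E); last first.
  by apply: cover_number_ge1; exists x; apply: cball_self; rewrite ltW.
rewrite lee_fin -[leRHS]mulr1 ler_pM ?powR_ge0//.
- by rewrite le_min (ltW C0) ler01.
- by rewrite ge_min lexx orbT.
rewrite [leRHS](_ : 1 = 1 `^ alpha); last by rewrite powR1.
rewrite ge0_ler_powR ?nnegrE ?(ltW a0)//.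
  by rewrite divr_ge0 ?ltW.
by rewrite ler_pdivrMr// mul1r.
Qed.

End lower_dimension_lemmas.

(** * The union of successive neighbourhoods of a point *)

Section cascade.
Context {R : realType} {Y : metricType R} (x0 : Y) (d : R).
Hypothesis d0 : 0 < d.

Let w n : R := d / 2 ^+ n.

Let w_gt0 n : 0 < w n.
Proof. by rewrite divr_gt0// exprn_gt0. Qed.

Let wS n : w n = w n.+1 * 2.
Proof. by rewrite /w exprSr; field; rewrite expf_neq0. Qed.

Fixpoint cascade_stage n : set Y :=
  if n is m.+1
  then [set y | exists2 x, cascade_stage m x & mdist x y < d / 2 ^+ m]
  else [set x0].

Definition cascade : set Y := \bigcup_n cascade_stage n.

Lemma cascade_stageS n x y :
  cascade_stage n x -> mdist x y < w n -> cascade_stage n.+1 y.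
Proof. by exists x. Qed.

Lemma open_cascade : open cascade.
Proof.
rewrite openE => y [n _ ny]; apply/nbhs_ballP; exists (w n) => //= z.
rewrite ballEmdist /= => yz; exists n.+1 => //.
exact: cascade_stageS yz.
Qed.

Lemma cascade_stageD n k y : cascade_stage n y -> cascade_stage (n + k) y.
Proof.
move=> ny; elim: k => [|k IH]; rewrite ?addn0 // addnS.
by apply: cascade_stageS IH _; rewrite mdistxx.
Qed.

(** The radii [w m], ..., [w (m + k - 1)] of the intermediate steps form a geometric sum, equal to
    the stated bound. *)
Lemma cascade_ancestor m k y : cascade_stage (m + k) y ->
  exists2 z, cascade_stage m z & mdist z y <= 2 * w m - 2 * w (m + k).
Proof.
elim: k y => [|k IH] y.
  by rewrite addn0 => my; exists y => //; rewrite mdistxx subrr.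
rewrite addnS => -[x /IH[z mz zx] xy]; exists z => //.
have := metric_triangle z x y; have := wS (m + k).
by rewrite -/(w (m + k)) in xy; lra.
Qed.

Lemma cascade_near m y : cascade y ->
  exists2 z, cascade_stage m z & mdist z y < 2 * w m.
Proof.
(* Stages increase, so [y] may be moved up to stage [m + n], which has an ancestor in stage [m] even
   when [n < m]. *)
move=> [n _ /(cascade_stageD _ m)]; rewrite addnC => /cascade_ancestor[z mz zy].
by exists z => //; have := w_gt0 (m + n); lra.
Qed.

Lemma cascade_ball y : cascade y -> mdist x0 y < 2 * d.
Proof. by move=> /(cascade_near 0)[z ->]; rewrite /w expr0 divr1. Qed.

Lemma cascade_fat y s : cascade y -> 0 < s <= 4 * d ->
  exists z, cball z (16^-1 * s) `<=` cascade `&` cball y s.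
Proof.
move=> cy /andP[s0 sd].
have ex : exists m, 4 * w m <= s.
  exists (Num.bound (4 * d / s)).
  rewrite /w mulrA ler_pdivrMr ?exprn_gt0// [s * _]mulrC -ler_pdivrMr// ltW//.
  exact: upper_nthrootP.
have [m ms mmin] := ex_minnP ex.
(* By minimality of [m]; for [m = 0] this is where [s <= 4 * d] enters. *)
have sm : s <= 8 * w m.
  case: m ms mmin => [|m] _ mmin; first by rewrite /w expr0 divr1; lra.
  have : ~~ (4 * w m <= s) by apply/negP => /mmin; rewrite ltnn.
  by rewrite -ltNge; have := wS m; lra.
have [z mz zy] := cascade_near m _ cy.
(* Here [s / 16 <= w m / 2], so [t] enters stage [m.+1]; and [t] is within
   [2 * w m + s / 16 <= s / 2 + s / 16] of [y]. *)
exists z => t; rewrite /cball /= => zt; split.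
  by exists m.+1 => //; apply: cascade_stageS mz _; lra.
have := metric_triangle y z t; rewrite (metric_sym y z).
by have := w_gt0 m; lra.
Qed.

(** Stated for any isometric copy of the cascade, so that it applies both to a subspace of [Y] and
    to a subspace of the subspace [U]. *)
Lemma dim_L_cascade_isometry (X : metricType R) (f : X -> Y) :
  (forall x y, mdist (f x) (f y) = mdist x y) -> range f = cascade ->
  (dim_L Y <= dim_L X)%E.
Proof.
move=> isof rf.
have [x _ _] : range f x0 by rewrite rf; exists 0%N.
apply: (dim_L_isometry _ _ f 16^-1 x isof).
- by rewrite rf; exact: open_cascade.
- by rewrite invr_gt0 ltr0n/= invf_le1 ?ler1n// ltr0n.
move=> y s s0 sX.
have cf u : cascade (f u) by rewrite -rf; exists u.
have sd : s <= 4 * d.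
  rewrite -lee_fin; apply: le_trans sX _.
  apply: ge_ereal_sup => _ [[a b] _ <-] /=; rewrite lee_fin -isof.
  have := metric_triangle (f a) x0 (f b); rewrite (metric_sym (f a) x0).
  have := cascade_ball _ (cf a); have := cascade_ball _ (cf b); lra.
have [|z zs] := cascade_fat _ s (cf y); first by rewrite s0.
exists z => t /zs[]; rewrite -rf => -[u _ <-] ys; exists u => //.
by rewrite /cball /= -isof.
Qed.

End cascade.

Theorem lemma2p1 (R : realType) (Y : metricType R) (U : set Y)
    (oU : open U) (U0 : U !=set0) :
  (exists V : set Y,
      [/\ open V, V `<=` U & (dim_L Y <= dim_L V)%E]) /\
  (dim_L Y <= dim_ML U)%E.
Proof.
have [x0 Ux0] := U0.
have /nbhs_ballP[e /= e0 eU] : nbhs x0 U by apply: open_nbhs_nbhs.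
(* The cascade stays within distance [2 * d] of [x0], so [d = e / 2] keeps it in the ball of radius
   [e]. *)
have d0 : 0 < e / 2 by apply: divr_gt0.
pose V := cascade x0 (e / 2).
have VU : V `<=` U.
  move=> y /(cascade_ball _ _ d0) xy; apply: eU; rewrite ballEmdist /=; lra.
split.
  exists V; split => //; first exact: open_cascade.
  apply: (dim_L_cascade_isometry x0 _ d0 _ set_val) => //.
  apply/seteqP; split=> [_ [v _ <-]|y Vy]; first exact: set_valP.
  by exists (SigSub (mem_set Vy)).
pose E : set U := set_val @^-1` V.
apply: (@le_trans _ _ (dim_L E)); last by apply: ereal_sup_ubound; exists E.
apply: (dim_L_cascade_isometry x0 _ d0 _ (set_val \o set_val)) => //.
apply/seteqP; split => [_ [[u uE] _ <-]|y Vy]; first exact: set_mem uE.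
have yU := mem_set (VU _ Vy).
have yE : SigSub yU \in E by apply: mem_set.
by exists (SigSub yE).
Qed.
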